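(* Let $G=(V,E)$ be a computation graph with $n=|V|$ vertices, evaluated in parallel on $p$ processors, each with a private fast memory of size $M$. Let $\lambda_1(\tilde L)\le\dots\le\lambda_n(\tilde L)$ be the eigenvalues of $\tilde L$ in increasing order. Then for every positive integer $k$, in any such parallel evaluation at least one processor incurs a number of I/Os $J^*_G$ satisfying $$J^*_G \;\geq\; \left\lfloor\frac{n}{kp}\right\rfloor \sum_{i=1}^k \lambda_i(\tilde L) \;-\; 2kM.$$
   Context: A computation graph is a finite directed acyclic graph $G=(V,E)$. Each vertex is an operation producing a single element, and an edge $(u,v)$ means the result of $u$ is an operand of $v$. Parallel execution model: there are $p$ processors, each with its own fast memory holding at most $M$ elements, together with unbounded slow memory. Every vertex is evaluated exactly once (no recomputation) by exactly one processor, respecting the dependencies of $G$. No assumption is made on how the work is distributed among processors. To evaluate a vertex, all its operands must be in the evaluating processor's fast memory. A value that is evicted while still needed must first be written out. The I/O of a processor counts each element it communicates with slow memory or with another processor. As in the sequential non-trivial I/O convention, inputs can be placed directly into fast memory and outputs reported at no cost. $\tilde L=\tilde D-\tilde A$ is the Laplacian of the weighted undirected graph $\tilde G$ on $V$. For each directed edge $(u,v)\in E$, $\tilde G$ contains the undirected edge $\{u,v\}$ with weight $1/d_{out}(u)$, where $d_{out}$ is out-degree in $G$. *)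

(* Defs.v *)
From HB Require Import structures.
From mathcomp Require Import all_boot all_order all_algebra.
From mathcomp Require Import reals.
Set Implicit Arguments. Unset Strict Implicit. Unset Printing Implicit Defensive.
Import Order.TTheory GRing.Theory Num.Theory.
Local Open Scope ring_scope.

Definition dag (n : nat) (E : rel 'I_n) : bool :=
  [forall x : 'I_n, ~~ [exists y : 'I_n, E x y && connect E y x]].

Definition dout (n : nat) (E : rel 'I_n) (u : 'I_n) : nat := #|[set v | E u v]|.

(** Weighted adjacency of tilde G: each directed edge (u,v) gives the undirected
    edge {u,v} with weight 1/d_out(u). *)
Definition wadj (R : numFieldType) (n : nat) (E : rel 'I_n) : 'M[R]_n :=
  \matrix_(u, v) ((E u v)%:R / (dout E u)%:R + (E v u)%:R / (dout E v)%:R).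

Definition laplacian (R : numFieldType) (n : nat) (E : rel 'I_n) : 'M[R]_n :=
  diag_mx (\row_u \sum_v wadj R E u v) - wadj R E.

Inductive move (n p : nat) : Type :=
  | PCompute of 'I_p & 'I_n
  | PLoad of 'I_p & 'I_n
  | PStore of 'I_p & 'I_n
  | PSend of 'I_p & 'I_p & 'I_n
  | PEvict of 'I_p & 'I_n.

Record pstate (n p : nat) := PState {
  fast : 'I_p -> {set 'I_n};
  slow : {set 'I_n};
  evaluated : {set 'I_n}
}.

Definition init_state (n p : nat) : pstate n p :=
  PState (fun _ => set0) set0 set0.

Definition upd (n p : nat) (f : 'I_p -> {set 'I_n}) (q : 'I_p) (A : {set 'I_n}) :=
  fun r => if r == q then A else f r.

Definition move_ok (n p : nat) (E : rel 'I_n) (M : nat) (s : pstate n p)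
    (m : move n p) : bool :=
  match m with
  | PCompute q v => [&& v \notin evaluated s,
                      [forall u, E u v ==> (u \in fast s q)] &
                      #|v |: fast s q| <= M]%N
  | PLoad q v => (v \in slow s) && (#|v |: fast s q| <= M)%N
  | PStore q v => v \in fast s q
  | PSend q q' v => [&& v \in fast s q, q != q' & #|v |: fast s q'| <= M]%N
  | PEvict q v => v \in fast s q
  end.

Definition move_eff (n p : nat) (s : pstate n p) (m : move n p) : pstate n p :=
  match m with
  | PCompute q v => PState (upd (fast s) q (v |: fast s q)) (slow s) (v |: evaluated s)
  | PLoad q v => PState (upd (fast s) q (v |: fast s q)) (slow s) (evaluated s)
  | PStore q v => PState (fast s) (v |: slow s) (evaluated s)
  | PSend q q' v => PState (upd (fast s) q' (v |: fast s q')) (slow s) (evaluated s)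
  | PEvict q v => PState (upd (fast s) q (fast s q :\ v)) (slow s) (evaluated s)
  end.

Fixpoint valid_run (n p : nat) (E : rel 'I_n) (M : nat) (s : pstate n p)
    (ms : seq (move n p)) : Prop :=
  match ms with
  | [::] => True
  | m :: ms' => move_ok E M s m /\ valid_run E M (move_eff s m) ms'
  end.

(** A parallel evaluation of G on p processors with fast memories of size M:
    a valid run from the empty state after which every vertex has been
    evaluated (each exactly once, enforced by [move_ok]). *)
Definition parallel_evaluation (n p : nat) (E : rel 'I_n) (M : nat)
    (ms : seq (move n p)) : Prop :=
  valid_run E M (init_state n p) ms /\
  evaluated (foldl (@move_eff n p) (init_state n p) ms) = setT.

Definition move_io (n p : nat) (r : 'I_p) (m : move n p) : nat :=
  match m with
  | PLoad q _ | PStore q _ => (q == r)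
  | PSend q q' _ => (q == r) + (q' == r)
  | _ => 0
  end.

Definition io (n p : nat) (r : 'I_p) (ms : seq (move n p)) : nat :=
  \sum_(m <- ms) move_io r m.

(* Main.v *)
(** Some processor [q] evaluates at least [n / p] vertices.  Cut the run into
    [k] segments in each of which [q] evaluates exactly [b = n %/ (k * p)]
    vertices, and let [S_1, ..., S_k] be the resulting disjoint sets of vertices.

    For a set [L] of storage locations, a value can be found in [L] after a run
    only if it was there before, was computed there, or was moved into [L] from
    outside.  With [L] the fast memory of [q], the operands of [S_j] from
    outside [S_j] were in that memory when the segment began or were moved into
    it; with [L] the complement, the values of [S_j] needed outside [S_j] are in
    that memory when the segment ends or were moved out of it.  So the boundary
    of [S_j] has at most [2 * M] vertices more than the I/O of [q] during the
    segment.

    A vertex has total outgoing weight at most 1, hence the weight of the cut of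
    [S_j] is at most the size of its boundary.  This weight is the quadratic
    form of the Laplacian at the indicator of [S_j], and Ky Fan's inequality for
    the normalised indicators bounds the sum of the [k] smallest eigenvalues by
    the sum of the cuts divided by [b]. *)
Require Import Defs.
From HB Require Import structures.
From mathcomp Require Import all_boot all_order all_algebra.
From mathcomp Require Import perm unstable reals complex.
Set Implicit Arguments.
Unset Strict Implicit.
Unset Printing Implicit Defensive.
Import Order.TTheory GRing.Theory Num.Theory.

Local Open Scope nat_scope.

Lemma card_guarded_set1 (T : finType) (b : bool) (x : T) :
  #|[set y | b && (y == x)]| = b.
Proof.
case: b; first by rewrite -[RHS](cards1 x); apply: eq_card => y; rewrite !inE.
by apply: eq_card0 => y; rewrite inE.
Qed.

Lemma flatten_take_nth_drop (T : Type) (ss : seq (seq T)) i : i < size ss ->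
  flatten ss = flatten (take i ss) ++ nth [::] ss i ++ flatten (drop i.+1 ss).
Proof.
by move=> lt_i; rewrite -{1}(cat_take_drop i ss) (drop_nth [::]) // flatten_cat.
Qed.

Definition edge_sources n (E : rel 'I_n) (A B : {set 'I_n}) : {set 'I_n} :=
  [set u in A | [exists v in B, E u v]].

Definition boundary n (E : rel 'I_n) (S : {set 'I_n}) : {set 'I_n} :=
  edge_sources E S (~: S) :|: edge_sources E (~: S) S.

Lemma card_boundary n (E : rel 'I_n) (S : {set 'I_n}) :
  #|boundary E S| = #|edge_sources E S (~: S)| + #|edge_sources E (~: S) S|.
Proof.
apply/eqP; rewrite (leq_card_setU _ _).2; apply/pred0P => u /=.
by rewrite !inE; case: (u \in S); rewrite ?andbF.
Qed.

(** * Runs *)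

Section Runs.
Variables (n p M : nat) (E : rel 'I_n).
Implicit Types (s : pstate n p) (m : move n p) (ms seg : seq (move n p)).
Implicit Types (q r : 'I_p) (u v w : 'I_n) (a : option 'I_p).
Implicit Types (L : {set option 'I_p}) (segs : seq (seq (move n p))).

Definition run s ms := foldl (@move_eff n p) s ms.

(* A storage location is [Some q] for the fast memory of [q] or [None] for slow
   memory. *)
Definition contents s a : {set 'I_n} :=
  if a is Some q then fast s q else slow s.

Definition held L s : {set 'I_n} := \bigcup_(a in L) contents s a.

Definition move_computed L m : {set 'I_n} :=
  if m is PCompute q v then [set w | (Some q \in L) && (w == v)] else set0.

Definition move_imported L m : {set 'I_n} :=
  match m with
  | PLoad q v => [set w | (None \notin L) && (Some q \in L) && (w == v)]
  | PStore q v => [set w | (Some q \notin L) && (None \in L) && (w == v)]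
  | PSend q r v => [set w | (Some q \notin L) && (Some r \in L) && (w == v)]
  | _ => set0
  end.

Definition computed L ms := \bigcup_(m <- ms) move_computed L m.

Definition imported L ms := \bigcup_(m <- ms) move_imported L m.

Lemma run_cat s ms1 ms2 : run s (ms1 ++ ms2) = run (run s ms1) ms2.
Proof. exact: foldl_cat. Qed.

Lemma valid_run_cat s ms1 ms2 :
  valid_run E M s (ms1 ++ ms2) <->
  valid_run E M s ms1 /\ valid_run E M (run s ms1) ms2.
Proof.
elim: ms1 s => [|m ms1 IH] s /=; first by split=> [|[]].
by rewrite IH; split=> [[? []]|[[]]].
Qed.

Lemma computed_cat L ms1 ms2 :
  computed L (ms1 ++ ms2) = computed L ms1 :|: computed L ms2.
Proof. exact: big_cat. Qed.

Lemma computed_setC L ms :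
  computed setT ms = computed L ms :|: computed (~: L) ms.
Proof.
rewrite -big_split; apply: eq_bigr => -[q v|??|??|???|??] _ /=;
  rewrite ?setU0 //.
by apply/setP => w; rewrite !inE -andb_orl orbN.
Qed.

Lemma imported_cat L ms1 ms2 :
  imported L (ms1 ++ ms2) = imported L ms1 :|: imported L ms2.
Proof. exact: big_cat. Qed.

Lemma imported_setT ms : imported setT ms = set0.
Proof. by apply: big1 => -[] *; apply/setP => w; rewrite !inE. Qed.

Lemma held_init L : held L (init_state n p) = set0.
Proof. by apply: big1 => -[]. Qed.

Lemma held_setC L s : held setT s = held L s :|: held (~: L) s.
Proof. by rewrite /held -(setUCr L) bigcup_setU. Qed.

Lemma contents_upd s q (A ev : {set 'I_n}) a :
  contents (PState (upd (fast s) q A) (slow s) ev) a =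
  if a == Some q then A else contents s a.
Proof. by case: a. Qed.

Lemma held_move_sub L s m : move_ok E M s m ->
  held L (move_eff s m) \subset
  held L s :|: (move_imported L m :|: move_computed L m).
Proof.
move=> ok; apply/subsetP => u /bigcupP[a La].
rewrite !in_setU; have [//|/bigcupP not_held] := boolP (u \in held L s).
have absent b : u \in contents s b -> b \notin L.
  by move=> ub; apply/negP => Lb; case: not_held; exists b.
have {not_held}absent_a : u \in contents s a -> false by move=> /absent/negP[].
case: m ok => [q v|q v|q v|q r v|q v] /= ok; rewrite ?contents_upd.
- case: eqP => [eq_a|_ /absent_a //]; rewrite eq_a in La absent_a.
  by rewrite !inE La => /predU1P[->|/absent_a //]; rewrite eqxx.
- case: eqP => [eq_a|_ /absent_a //]; rewrite eq_a in La absent_a.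
  rewrite !inE La => /predU1P[eq_uv|/absent_a //].
  have /andP[slow_v _] := ok.
  by rewrite eq_uv eqxx (absent None) // eq_uv.
- case: a La absent_a => [r|] La absent_a /=; first by move/absent_a.
  rewrite !inE La => /predU1P[eq_uv|/absent_a //].
  by rewrite eq_uv eqxx (absent (Some q)) // eq_uv.
- case: eqP => [eq_a|_ /absent_a //]; rewrite eq_a in La absent_a.
  rewrite !inE La => /predU1P[eq_uv|/absent_a //].
  have /and3P[fast_v _ _] := ok.
  by rewrite eq_uv eqxx (absent (Some q)) // eq_uv.
- case: eqP => [eq_a|_ /absent_a //]; rewrite eq_a in absent_a.
  by rewrite !inE => /andP[_ /absent_a].
Qed.

Lemma held_run_sub L s ms : valid_run E M s ms ->
  held L (run s ms) \subset held L s :|: (imported L ms :|: computed L ms).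
Proof.
elim: ms s => [|m ms IH] s /=; first by rewrite subsetUl.
case=> ok /IH /subset_trans; apply; rewrite /imported /computed !big_cons.
apply: subset_trans (setSU _ (held_move_sub L ok)) _.
by rewrite -setUA setUACA.
Qed.

Lemma evaluated_run s ms :
  evaluated (run s ms) = evaluated s :|: computed setT ms.
Proof.
elim: ms s => [|m ms IH] s; first by rewrite /computed big_nil setU0.
rewrite [run _ _]/= IH /computed big_cons setUA; congr (_ :|: _).
by apply/setP => w; case: m => *; rewrite /= !inE ?orbF // orbC.
Qed.

Lemma held_sub_evaluated L ms (s := run (init_state n p) ms) :
  valid_run E M (init_state n p) ms -> held L s \subset evaluated s.
Proof.
move=> valid; apply: (@subset_trans _ _ (held setT s)).
  by rewrite (held_setC L) subsetUl.
apply: subset_trans (held_run_sub _ valid) _.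
by rewrite held_init imported_setT !set0U evaluated_run subsetUr.
Qed.

Lemma card_fast_run s ms q : valid_run E M s ms ->
  #|fast s q| <= M -> #|fast (run s ms) q| <= M.
Proof.
elim: ms s => [|m ms IH] s //= [ok valid] le_M; apply: (IH _ valid).
case: m ok {valid} => [r v|r v|r v|r r' v|r v] /= ok; rewrite /upd //.
- by case: eqP => // _; case/and3P: ok.
- by case: eqP => // _; case/andP: ok.
- by case: eqP => // _; case/and3P: ok.
- case: eqP => // <-; apply: leq_trans le_M.
  by rewrite subset_leq_card // subD1set.
Qed.

Lemma mem_computedP L v ms :
  reflect (exists q ms1 ms2, Some q \in L /\ ms = ms1 ++ PCompute q v :: ms2)
          (v \in computed L ms).
Proof.
apply: (iffP idP) => [|[q [ms1 [ms2 [Lq ->]]]]]; last first.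
  by rewrite computed_cat /computed big_cons /= !inE Lq eqxx orbT.
elim: ms => [|m ms IH]; first by rewrite /computed big_nil inE.
rewrite /computed big_cons inE => /orP[|/IH[q [ms1 [ms2 [Lq ->]]]]]; last first.
  by exists q, (m :: ms1), ms2.
case: m => [q w|??|??|???|??] /=; rewrite inE // => /andP[Lq /eqP->].
by exists q, [::], ms.
Qed.

Lemma computedS L1 L2 ms :
  L1 \subset L2 -> computed L1 ms \subset computed L2 ms.
Proof.
move=> /subsetP sub12; apply/subsetP => v.
move=> /mem_computedP[q [ms1 [ms2 [L1q ->]]]].
by apply/mem_computedP; exists q, ms1, ms2; split; first exact: sub12.
Qed.

Lemma computed_fresh L s ms :
  valid_run E M s ms -> [disjoint computed L ms & evaluated s].
Proof.
move=> valid; apply/pred0P => v /=; apply/negP => /andP[].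
move=> /mem_computedP[q [ms1 [ms2 [_ eq_ms]]]] ev.
move: valid; rewrite eq_ms valid_run_cat => -[_ /= [/and3P[+ _ _] _]].
by rewrite evaluated_run inE ev.
Qed.

Lemma disjoint_computed_cat L1 L2 s ms1 ms2 : valid_run E M s (ms1 ++ ms2) ->
  [disjoint computed L1 ms1 & computed L2 ms2].
Proof.
move=> /valid_run_cat[_ /(computed_fresh L2)]; rewrite disjoint_sym.
by apply: disjointWr; rewrite evaluated_run subsetU // computedS ?orbT ?subsetT.
Qed.

Lemma disjoint_computed L1 L2 s ms : valid_run E M s ms ->
  [disjoint L1 & L2] -> [disjoint computed L1 ms & computed L2 ms].
Proof.
move=> valid disjL; apply/pred0P => v /=; apply/negP => /andP[].
move=> /mem_computedP[q [ms1 [ms2 [L1q eq_ms]]]].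
move: valid; rewrite eq_ms -cat1s => valid.
rewrite catA !computed_cat !in_setU => /orP[/orP[]|].
- move/(disjointFr (disjoint_computed_cat L2 L1 valid)).
  by rewrite computed_cat /computed big_seq1 !inE L1q eqxx.
- by rewrite /computed big_seq1 inE (disjointFr disjL L1q).
- rewrite catA in valid.
  move/(disjointFl (disjoint_computed_cat L1 L2 valid)).
  by rewrite computed_cat in_setU /computed big_seq1 !inE L1q eqxx orbT.
Qed.

Lemma operand_origin L s ms u v : valid_run E M s ms -> E u v ->
  v \in computed L ms ->
  u \in held L s :|: (imported L ms :|: computed L ms).
Proof.
move=> valid Euv /mem_computedP[q [ms1 [ms2 [Lq eq_ms]]]].
move: valid; rewrite eq_ms => /valid_run_cat[valid1 /= [/and3P[_ + _] _]].
move=> /forallP/(_ u)/implyP/(_ Euv) fast_u.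
have : u \in held L (run s ms1) by apply/bigcupP; exists (Some q).
move/(subsetP (held_run_sub L valid1)); apply: subsetP.
by rewrite imported_cat computed_cat setUS // setUSS // subsetUl.
Qed.

Lemma edge_sources_into_computed_sub L s seg (S := computed L seg) :
  valid_run E M s seg ->
  edge_sources E (~: S) S \subset held L s :|: imported L seg.
Proof.
move=> valid; apply/subsetP => u; rewrite inE in_setC => /andP[/negPf Su].
move=> /exists_inP[v Sv Euv]; have := operand_origin valid Euv Sv.
by rewrite !in_setU -/S Su orbF.
Qed.

Lemma edge_sources_out_of_computed_sub L pre seg post (S := computed L seg) :
  parallel_evaluation E M (pre ++ seg ++ post) ->
  edge_sources E S (~: S) \subset
  held L (run (init_state n p) (pre ++ seg)) :|: imported (~: L) seg.
Proof.
case; rewrite -/(run _ _) => valid all_evaluated.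
have /valid_run_cat[valid_pre valid_seg_post] := valid.
have /valid_run_cat[valid_seg valid_post] := valid_seg_post.
rewrite run_cat; set s0 := run _ pre in valid_seg_post valid_seg valid_post *.
apply/subsetP => u; rewrite inE in_setU => /andP[Su /exists_inP[v + Euv]].
rewrite in_setC => /negPf notSv.
have fresh_u : u \in evaluated s0 = false.
  by rewrite (disjointFr (computed_fresh L valid_seg)).
(* [u] is new in the segment and is computed in [L], so a copy of it outside [L]
   can only have been moved there. *)
have escapes : u \in held (~: L) s0 :|:
    (imported (~: L) seg :|: computed (~: L) seg) -> u \in imported (~: L) seg.
  rewrite !in_setU => /or3P[held_u|//|].
    by rewrite (subsetP (held_sub_evaluated (~: L) valid_pre)) in fresh_u.
  rewrite (disjointFr (disjoint_computed valid_seg _) Su) //.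
  by rewrite -setI_eq0 setICr.
have : v \in evaluated (run (init_state n p) (pre ++ seg ++ post)).
  by rewrite all_evaluated inE.
rewrite evaluated_run !computed_cat !in_setU in_set0 /=.
case/or3P => [v_pre|v_seg|v_post].
- have := operand_origin valid_pre Euv v_pre.
  rewrite held_init imported_setT !set0U => u_pre.
  by move: fresh_u; rewrite evaluated_run in_setU u_pre orbT.
- rewrite (computed_setC L) in_setU -/S notSv /= in v_seg.
  by rewrite (escapes (operand_origin valid_seg Euv v_seg)) orbT.
- have := operand_origin valid_post Euv v_post.
  rewrite imported_setT set0U (held_setC L) -setUA !in_setU.
  case/or3P => [->//|held_u|].
    by rewrite (escapes (subsetP (held_run_sub _ valid_seg) _ held_u)) orbT.
  by rewrite (disjointFr (disjoint_computed_cat _ _ valid_seg_post) Su).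
Qed.

Lemma card_imported_le_io q ms :
  #|imported [set Some q] ms| + #|imported (~: [set Some q]) ms| <= io q ms.
Proof.
apply: leq_trans (leq_add (card_big_setU _ _ _) (card_big_setU _ _ _)) _.
rewrite -big_split; apply: leq_sum => m _ /=.
case: m => [r v|r v|r v|r r' v|r v] /=;
  rewrite ?cards0 ?card_guarded_set1 ?inE ?(inj_eq Some_inj) //=.
- by rewrite addn0.
- by case: (r == q).
- by case: (r == q); case: (r' == q).
Qed.

Lemma card_boundary_computed_le q pre seg post :
  parallel_evaluation E M (pre ++ seg ++ post) ->
  #|boundary E (computed [set Some q] seg)| <= io q seg + 2 * M.
Proof.
move=> eval; have [/valid_run_cat[valid_pre valid_seg_post] _] := eval.
have /valid_run_cat[valid_seg _] := valid_seg_post.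
have card_held ms : valid_run E M (init_state n p) ms ->
    #|held [set Some q] (run (init_state n p) ms)| <= M.
  by move=> valid; rewrite /held big_set1 card_fast_run //= cards0.
have out_sub := edge_sources_out_of_computed_sub [set Some q] eval.
have in_sub := edge_sources_into_computed_sub [set Some q] valid_seg.
have /leq_trans out_le := subset_leq_card out_sub.
have /leq_trans in_le := subset_leq_card in_sub.
rewrite card_boundary addnC.
apply: leq_trans (leq_add (in_le _ (leq_card_setU _ _))
                          (out_le _ (leq_card_setU _ _))) _.
rewrite addnACA addnC mul2n -addnn leq_add ?card_imported_le_io //.
by rewrite leq_add ?card_held // valid_run_cat.
Qed.

Lemma exists_busy_processor ms : 0 < p -> parallel_evaluation E M ms ->
  exists q, n <= p * #|computed [set Some q] ms|.
Proof.
move=> p_gt0 [_]; rewrite -/(run _ _) evaluated_run set0U => all_computed.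
pose load q := #|computed [set Some q] ms|.
have [|q _ max_load] := @eq_bigmax_cond _ 'I_p load; first by rewrite card_ord.
exists q; rewrite -[leqLHS]card_ord -cardsT -all_computed.
apply: (@leq_trans #|\bigcup_r computed [set Some r] ms|).
  apply/subset_leq_card/subsetP => v /mem_computedP[r [ms1 [ms2 [_ ->]]]].
  apply/bigcupP; exists r => //; apply/mem_computedP; exists r, ms1, ms2.
  by rewrite set11.
apply: leq_trans (card_big_setU _ _ _) _.
rewrite -[p in p * _]card_ord -sum_nat_const -/(load q) -max_load.
by apply: leq_sum => r _; apply: leq_bigmax_cond.
Qed.

Lemma exists_prefix_computed L c ms : c <= #|computed L ms| ->
  exists ms1 ms2, ms = ms1 ++ ms2 /\ #|computed L ms1| = c.
Proof.
elim/last_ind: ms => [|ms m IH] le_c.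
  exists [::], [::]; split=> //; apply/eqP.
  by move: le_c; rewrite /computed big_nil cards0 leqn0 eq_sym.
have [/IH[ms1 [ms2 [-> card_ms1]]]|lt_c] := leqP c #|computed L ms|.
  by exists ms1, (rcons ms2 m); rewrite rcons_cat.
exists (rcons ms m), [::]; rewrite cats0; split=> //; apply/eqP.
rewrite eqn_leq le_c andbT; apply: leq_trans lt_c.
rewrite -cats1 computed_cat (leq_trans (leq_card_setU _ _)) // -addn1 leq_add2l.
rewrite /computed big_seq1; case: m {le_c} => [q v|??|??|???|??];
  by rewrite /= ?cards0 ?card_guarded_set1 ?leq_b1.
Qed.

Lemma exists_segments_computed L k b ms : k * b <= #|computed L ms| ->
  exists segs rest, [/\ ms = flatten segs ++ rest, size segs = k &
    forall i, i < k -> #|computed L (nth [::] segs i)| = b].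
Proof.
elim: k ms => [|k IH] ms; first by exists [::], ms.
rewrite mulSn => le_ms.
have [seg [ms' [eq_ms card_seg]]] :=
  exists_prefix_computed (leq_trans (leq_addr _ _) le_ms).
have /IH[segs [rest [eq_ms' size_segs card_segs]]] : k * b <= #|computed L ms'|.
  rewrite -(leq_add2l b) (leq_trans le_ms) // eq_ms computed_cat -card_seg.
  exact: leq_card_setU.
exists (seg :: segs), rest; split=> [||[|i] lt_i] //=; last exact: card_segs.
  by rewrite eq_ms eq_ms' catA.
by rewrite size_segs.
Qed.

Lemma disjoint_computed_segments L s segs rest i j :
  valid_run E M s (flatten segs ++ rest) ->
  i < size segs -> j < size segs -> i != j ->
  [disjoint computed L (nth [::] segs i) & computed L (nth [::] segs j)].
Proof.
move=> valid; wlog lt_ij : i j / i < j.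
  move=> IH lt_i lt_j; rewrite neq_ltn => /orP[] lt_ij.
    by apply: IH; rewrite ?neq_ltn ?lt_ij.
  by rewrite disjoint_sym; apply: IH; rewrite ?neq_ltn ?lt_ij.
move=> _ lt_j _; rewrite (flatten_take_nth_drop lt_j) -!catA in valid.
apply: disjointW (disjoint_computed_cat L L valid); last first.
  by rewrite computed_cat subsetUl.
have lt_i : i < size (take j segs) by rewrite size_takel // ltnW.
rewrite (flatten_take_nth_drop lt_i) nth_take // !computed_cat.
by rewrite (subset_trans (subsetUl _ _) (subsetUr _ _)).
Qed.

Lemma io_cat q ms1 ms2 : io q (ms1 ++ ms2) = io q ms1 + io q ms2.
Proof. exact: big_cat. Qed.

Lemma io_flatten q segs : io q (flatten segs) = \sum_(seg <- segs) io q seg.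
Proof. exact: big_flatten. Qed.

End Runs.

(** * Ky Fan's inequality *)

Local Open Scope ring_scope.
Local Open Scope sesquilinear_scope.

Lemma char_poly_similar (R : comUnitRingType) n (P A : 'M[R]_n) :
  P \in unitmx -> char_poly (invmx P *m A *m P) = char_poly A.
Proof.
move=> unitP; rewrite /char_poly /char_poly_mx.
have -> : 'X%:M - map_mx polyC (invmx P *m A *m P) =
    map_mx polyC (invmx P) *m ('X%:M - map_mx polyC A) *m map_mx polyC P.
  rewrite !map_mxM mulmxBr mulmxBl; congr (_ - _).
  by rewrite mul_mx_scalar -scalemxAl -map_mxM mulVmx // map_mx1 scalemx1.
by rewrite !det_mulmx mulrAC -det_mulmx -map_mxM mulVmx // map_mx1 det1 mul1r.
Qed.

Lemma normalmx_diagonalization (C : numClosedFieldType) n (A : 'M[C]_n)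
    (d : 'rV[C]_n) :
  A \is normalmx -> char_poly A = \prod_i ('X - (d 0 i)%:P) ->
  exists2 P, P \is unitarymx & A = P^t* *m diag_mx d *m P.
Proof.
move=> /orthomx_spectralP; set P := spectralmx A; set D := spectral_diag A.
have unitaryP : P \is unitarymx := spectral_unitarymx A.
move=> eA charA.
have /tuple_permP[s Ds] : perm_eq [tuple D 0 i | i < n] [tuple d 0 i | i < n].
  apply: prod_XsubC_eq; rewrite !big_tuple.
  under eq_bigr do rewrite tnth_mktuple.
  under [RHS]eq_bigr do rewrite tnth_mktuple.
  rewrite -charA eA char_poly_similar ?unitarymx_unit //.
  rewrite char_poly_trig ?diag_mx_is_trig //.
  by apply: eq_bigr => i _; rewrite mxE eqxx.
have {}Ds i : D 0 i = d 0 (s i).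
  by have /(congr1 (fun t => tnth t i)) := val_inj Ds; rewrite !tnth_mktuple.
exists (row_perm s^-1 P).
  apply/unitarymxP/matrixP => i j; have /unitarymxP/matrixP := unitaryP.
  move=> /(_ (s^-1 i)%g (s^-1 j)%g); rewrite !mxE (inj_eq perm_inj) => <-.
  by apply: eq_bigr => u _; rewrite !mxE.
apply/matrixP => u v; rewrite {1}eA invmx_unitary // -!mulmxA !mxE.
rewrite [RHS](reindex_perm s); apply: eq_bigr => i _.
by rewrite !mul_diag_mx !mxE Ds permK.
Qed.

Lemma gram_diag_ge0 (C : numClosedFieldType) k n (X : 'M[C]_(k, n)) i :
  0 <= (X^t* *m X) i i.
Proof.
rewrite mxE; apply: sumr_ge0 => j _.
by rewrite !mxE mulrC -normCK exprn_ge0.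
Qed.

Lemma unitarymx_gram_diag_le1 (C : numClosedFieldType) k n
    (X : 'M[C]_(k, n)) i :
  X \is unitarymx -> (X^t* *m X) i i <= 1.
Proof.
move=> /unitarymxP unitaryX; set G := X^t* *m X.
have G_ge0 : 0 <= G i i := gram_diag_ge0 X i.
have G_idem : G *m G = G by rewrite /G mulmxA -(mulmxA _ X) unitaryX mulmx1.
have G_herm j : G j i = (G i j)^*.
  have : G^t* = G by rewrite /G trmx_mul map_mxM /= trmxCK.
  by move/matrixP => /(_ j i); rewrite !mxE => <-.
(* As an orthogonal projection, [G] satisfies
   [G i i = \sum_j `|G i j| ^+ 2 >= G i i ^+ 2]. *)
have : G i i ^+ 2 <= G i i.
  rewrite -{2}G_idem [leRHS]mxE (bigD1 i) //= lerDl; apply: sumr_ge0 => j _.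
  by rewrite G_herm -normCK exprn_ge0.
have [->|G_neq0] := eqVneq (G i i) 0; first by rewrite ler01.
by rewrite expr2 ger_pMr // lt_def G_neq0.
Qed.

Lemma sum_smallest_le_weighted (R : numDomainType) n k (s : seq R)
    (c : 'I_n -> R) :
  size s = n -> sorted <=%R s -> (k <= n)%N ->
  (forall i, 0 <= c i <= 1) -> \sum_i c i = k%:R ->
  \sum_(i < k) s`_i <= \sum_(i < n) s`_i * c i.
Proof.
move=> size_s sorted_s le_kn c01 sum_c.
have le_s i j : (i <= j)%N -> (j < n)%N -> s`_i <= s`_j.
  move=> le_ij lt_jn; apply: le_sorted_leq_nth => //; rewrite inE size_s //.
  exact: leq_ltn_trans lt_jn.
pose w (i : 'I_n) := c i - (i < k)%:R.
have sum_w : \sum_i w i = 0.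
  rewrite sumrB sum_c -natr_sum -big_mkcond /=.
  by rewrite -(big_ord_widen n (fun=> 1%N)) // sum1_card card_ord subrr.
(* As [w] sums to 0, shifting [s] by the threshold [s`_k.-1] changes nothing; it
   makes both factors of each summand have the same sign. *)
have weighted_diff : \sum_(i < n) s`_i * c i - \sum_(i < k) s`_i =
    \sum_(i < n) (s`_i - s`_k.-1) * w i.
  under [RHS]eq_bigr do rewrite mulrBl.
  rewrite [RHS]sumrB -mulr_sumr sum_w mulr0 subr0.
  rewrite (big_ord_widen n (fun i => s`_i)) //.
  rewrite [X in _ - X]big_mkcond -sumrB.
  by apply: eq_bigr => i _; rewrite mulrBr mulr_natr -mulrb.
rewrite -subr_ge0 weighted_diff; apply: sumr_ge0 => i _; rewrite /w.
have /andP[c_ge0 c_le1] := c01 i; have [lt_ik|le_ki] := ltnP i k.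
  rewrite mulr_le0 // subr_le0 // le_s //; first by case: (k) lt_ik.
  by case: (k) lt_ik le_kn.
by rewrite subr0 mulr_ge0 // subr_ge0 le_s // (leq_trans (leq_pred k)).
Qed.

Lemma sum_smallest_eigenvalues_le_trace (C : numClosedFieldType) k n
    (A : 'M[C]_n) (X : 'M[C]_(k, n)) (lam : seq C) :
  A \is normalmx -> X \is unitarymx -> sorted <=%R lam ->
  char_poly A = \prod_(x <- lam) ('X - x%:P) ->
  \sum_(i < k) lam`_i <= \tr (X *m A *m X^t* ).
Proof.
move=> normalA unitaryX sorted_lam charA.
have size_lam : size lam = n.
  apply/eqP; rewrite -eqSS -(size_prod_XsubC _ id) -charA.
  by rewrite size_char_poly.
have [||P unitaryP eA] := @normalmx_diagonalization _ _ A (\row_i lam`_i) => //.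
  rewrite charA (big_nth 0) size_lam big_mkord.
  by apply: eq_bigr => i _; rewrite mxE.
set Y := X *m P^t*.
have unitaryY : Y \is unitarymx by rewrite mul_unitarymx // trmxC_unitary.
have -> : \tr (X *m A *m X^t* ) = \sum_(i < n) lam`_i * (Y^t* *m Y) i i.
  have -> : X *m A *m X^t* = Y *m diag_mx (\row_i lam`_i) *m Y^t*.
    by rewrite eA /Y trmx_mul map_mxM /= trmxCK !mulmxA.
  rewrite mxtrace_mulC mulmxA mul_mx_diag; apply: eq_bigr => i _.
  by rewrite [LHS]mxE mulrC mxE.
apply: sum_smallest_le_weighted => //.
- by rewrite -(mxrank_unitary unitaryX) rank_leq_col.
- by move=> i; rewrite gram_diag_ge0 unitarymx_gram_diag_le1.
- rewrite -/(\tr _) mxtrace_mulC; have /unitarymxP-> := unitaryY.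
  by rewrite mxtrace1.
Qed.

Lemma sum_smallest_eigenvalues_le_trace_sym (R : rcfType) k n (A : 'M[R]_n)
    (X : 'M[R]_(k, n)) (lam : seq R) :
  A^T = A -> X *m X^T = 1%:M -> sorted <=%R lam ->
  char_poly A = \prod_(x <- lam) ('X - x%:P) ->
  \sum_(i < k) lam`_i <= \tr (X *m A *m X^T).
Proof.
move=> symA orthoX sorted_lam charA; set f := real_complex R.
have conj_f m p (B : 'M[R]_(m, p)) : (map_mx f B)^t* = map_mx f B^T.
  by apply/matrixP => i j; rewrite !mxE; exact: conjc_real.
have f_normal : map_mx f A \is normalmx.
  by apply/normalmxP; rewrite conj_f symA.
have f_unitary : map_mx f X \is unitarymx.
  by apply/unitarymxP; rewrite conj_f -map_mxM orthoX map_mx1.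
have f_sorted : sorted <=%R (map f lam).
  by rewrite sorted_map; apply: sub_sorted sorted_lam => x y; rewrite /= lecR.
have f_char : char_poly (map_mx f A) = \prod_(x <- map f lam) ('X - x%:P).
  rewrite -map_char_poly charA rmorph_prod big_map; apply: eq_bigr => x _.
  exact: map_polyXsubC.
have := sum_smallest_eigenvalues_le_trace f_normal f_unitary f_sorted f_char.
rewrite conj_f -!map_mxM trace_map_mx -lecR; apply: le_trans.
rewrite rmorph_sum; apply: ler_sum => i _.
have [lt_i|le_i] := ltnP i (size lam); first by rewrite (nth_map 0).
by rewrite !nth_default ?size_map // rmorph0.
Qed.

Lemma sum_smallest_eigenvalues_le_block_sums (R : rcfType) k n (A : 'M[R]_n)
    (lam : seq R) (S : 'I_k -> {set 'I_n}) :
  A^T = A -> sorted <=%R lam -> char_poly A = \prod_(x <- lam) ('X - x%:P) ->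
  (forall j, S j != set0) -> (forall i j, i != j -> [disjoint S i & S j]) ->
  \sum_(i < k) lam`_i <=
  \sum_j (\sum_(u in S j) \sum_(v in S j) A u v) / #|S j|%:R.
Proof.
move=> symA sorted_lam charA S_neq0 disjS.
pose a j : R := (Num.sqrt #|S j|%:R)^-1.
have sqr_a j : a j * a j = #|S j|%:R^-1.
  by rewrite -expr2 exprVn sqr_sqrtr // ler0n.
pose X : 'M[R]_(k, n) := \matrix_(j, u) ((u \in S j)%:R * a j).
have XAX j : (X *m A *m X^T) j j =
    (\sum_(u in S j) \sum_(v in S j) A u v) / #|S j|%:R.
  rewrite -mulmxA mxE mulr_suml [RHS]big_mkcond; apply: eq_bigr => u _.
  rewrite !mxE; case: (u \in S j); last by rewrite !mul0r.
  rewrite mul1r mulr_sumr mulr_suml [RHS]big_mkcond; apply: eq_bigr => v _.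
  rewrite !mxE; case: (v \in S j); last by rewrite mul0r !mulr0.
  by rewrite mul1r mulrCA sqr_a.
under [leRHS]eq_bigr do rewrite -XAX.
apply: sum_smallest_eigenvalues_le_trace_sym => //.
apply/matrixP => i j; rewrite !mxE; have [->|neq_ij] := eqVneq i j.
  have card_S : #|S j|%:R != 0 :> R by rewrite pnatr_eq0 cards_eq0.
  under eq_bigr do rewrite !mxE mulrACA -natrM mulnb andbb sqr_a.
  by rewrite -mulr_suml -natr_sum -big_mkcond sum1_card divff.
apply: big1 => u _; rewrite !mxE mulrACA -natrM mulnb.
have [Si_u|] := boolP (u \in S i); last by rewrite mul0r.
by rewrite (disjointFr (disjS i j neq_ij)) // mul0r.
Qed.

(** * Cuts of the Laplacian *)

Lemma laplacian_sym (R : numFieldType) n (E : rel 'I_n) :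
  (laplacian R E)^T = laplacian R E.
Proof.
rewrite linearB /= tr_diag_mx; congr (_ - _).
by apply/matrixP => u v; rewrite !mxE addrC.
Qed.

Lemma laplacian_block_sum (R : numFieldType) n (E : rel 'I_n) (S : {set 'I_n}) :
  \sum_(u in S) \sum_(v in S) laplacian R E u v =
  \sum_(u in S) \sum_(v in ~: S) wadj R E u v.
Proof.
apply: eq_bigr => u uS; set W := wadj R E.
have diag_sum :
    \sum_(v in S) (diag_mx (\row_x \sum_y W x y)) u v = \sum_v W u v.
  rewrite (bigD1 u) //= big1 ?addr0 => [|v /andP[_ /negPf neq_vu]].
    by rewrite !mxE eqxx.
  by rewrite !mxE eq_sym neq_vu.
under eq_bigr do rewrite mxE [X in _ + X]mxE.
rewrite sumrB diag_sum (bigID (mem S)) /= addrAC subrr add0r.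
by apply: eq_bigl => v; rewrite inE.
Qed.

Lemma sum_out_weight_le (R : numFieldType) n (E : rel 'I_n) (A B : {set 'I_n}) :
  \sum_(u in A) \sum_(v in B) (E u v)%:R / (dout E u)%:R <=
  #|edge_sources E A B|%:R :> R.
Proof.
rewrite -sum1_card natr_sum [leRHS]big_mkcond [leLHS]big_mkcond.
apply: ler_sum => u _; rewrite inE; case: (u \in A) => //=.
case: existsP => [[w /andP[_ Euw]]|no_edge].
  have dout_gt0 : (0 : R) < (dout E u)%:R.
    by rewrite ltr0n card_gt0; apply/set0Pn; exists w; rewrite inE.
  rewrite -mulr_suml ler_pdivrMr // mul1r -natr_sum ler_nat /dout -sum1_card.
  rewrite [leqLHS]big_mkcond [leqRHS]big_mkcond leq_sum // => v _.
  by rewrite inE; case: (v \in B); case: (E u v).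
rewrite big1 // => v vB; have [Euv|_] := boolP (E u v); last by rewrite mul0r.
by case: no_edge; exists v; rewrite vB.
Qed.

Lemma sum_wadj_le (R : numFieldType) n (E : rel 'I_n) (A B : {set 'I_n}) :
  \sum_(u in A) \sum_(v in B) wadj R E u v <=
  (#|edge_sources E A B| + #|edge_sources E B A|)%:R.
Proof.
under eq_bigr do under eq_bigr do rewrite mxE.
under eq_bigr do rewrite big_split /=.
rewrite big_split natrD /= [X in _ + X <= _]exchange_big /=.
by rewrite lerD ?sum_out_weight_le.
Qed.

Lemma sum_smallest_eigenvalues_le_boundary (R : rcfType) k n b
    (E : rel 'I_n) (lam : seq R) (S : 'I_k -> {set 'I_n}) :
  sorted <=%R lam ->
  char_poly (laplacian R E) = \prod_(x <- lam) ('X - x%:P) ->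
  (forall j, #|S j| = b) -> (forall i j, i != j -> [disjoint S i & S j]) ->
  b%:R * (\sum_(i < k) lam`_i) <=
  (\sum_j #|boundary E (S j)|)%N%:R.
Proof.
move=> sorted_lam charL cardS disjS.
have [->|b_gt0] := posnP b; first by rewrite mul0r ler0n.
have b_gt0R : (0 : R) < b%:R by rewrite ltr0n.
rewrite mulrC -ler_pdivlMr //.
have S_neq0 j : S j != set0 by rewrite -card_gt0 cardS.
have := sum_smallest_eigenvalues_le_block_sums
  (laplacian_sym R E) sorted_lam charL S_neq0 disjS.
move=> /le_trans; apply; rewrite natr_sum mulr_suml; apply: ler_sum => j _.
rewrite cardS ler_pM2r ?invr_gt0 // laplacian_block_sum card_boundary.
exact: sum_wadj_le.
Qed.

Theorem theorem4p6 (R : realType) (n p M : nat) (E : rel 'I_n)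
    (lam : seq R) (ms : seq (move n p)) (k : nat) :
  dag E -> (0 < p)%N ->
  size lam = n -> sorted <=%R lam ->
  char_poly (laplacian R E) = \prod_(x <- lam) ('X - x%:P) ->
  (0 < k)%N ->
  parallel_evaluation E M ms ->
  exists q : 'I_p,
    (n %/ (k * p))%:R * (\sum_(i < k) lam`_i) - (2 * k * M)%:R <= (io q ms)%:R.
Proof.
move=> _ p_gt0 _ sorted_lam charL _ eval; set b := (n %/ (k * p))%N.
have [q busy] := exists_busy_processor p_gt0 eval; exists q.
have kb_le : (k * b <= #|computed [set Some q] ms|)%N.
  rewrite -(leq_pmul2l p_gt0) (leq_trans _ busy) // mulnA (mulnC p) mulnC.
  exact: leq_divM.
have [segs [rest [eq_ms size_segs card_segs]]] :=
  exists_segments_computed kb_le.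
rewrite eq_ms in eval *; have [valid _] := eval.
pose S (j : 'I_k) := computed [set Some q] (nth [::] segs j).
have disjS i j : i != j -> [disjoint S i & S j].
  by apply: (disjoint_computed_segments _ valid); rewrite size_segs ltn_ord.
have spectral_le := sum_smallest_eigenvalues_le_boundary
  sorted_lam charL (fun j : 'I_k => card_segs j (ltn_ord j)) disjS.
rewrite lerBlDr (le_trans spectral_le) // -natrD ler_nat.
have segment_le (j : 'I_k) :
    (#|boundary E (S j)| <= io q (nth [::] segs j) + 2 * M)%N.
  have lt_j : (j < size segs)%N by rewrite size_segs.
  rewrite (flatten_take_nth_drop lt_j) -!catA in eval.
  exact: card_boundary_computed_le eval.
apply: leq_trans (leq_sum _ (fun j _ => segment_le j)) _.
rewrite big_split /= sum_nat_const card_ord mulnCA mulnA leq_add2r.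
by rewrite io_cat io_flatten (big_nth [::]) size_segs big_mkord leq_addr.
Qed.
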